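(* Let $S=\{s_1,\dots,s_{|S|}\}$ be a finite set, $G=G_S$ the free group on $S$, and let $\theta_1,\dots,\theta_{|S|}$ be positive real numbers. Consider the multi-dimensional-time dynamical system (MDTDS) on the circle generated by $f_i(x)=x+\theta_i \bmod 1$, $i=1,\dots,|S|$. The set of fixed points of this MDTDS is $$\mathrm{Fix}\left(D^G_{\theta_1,\dots,\theta_{|S|}}\right)=\begin{cases}\emptyset, & \text{if } \theta_{i_0}\text{ is not an integer for some } i_0\in\{1,\dots,|S|\};\\ [0,1), & \text{if } \theta_i\in\mathbb{Z}\text{ for all } i=1,\dots,|S|.\end{cases}$$
   Context: The phase space is $X=[0,1]$ with the boundary points $0$ and $1$ identified (i.e. the circle $\mathbb{R}/\mathbb{Z}$), and $a\bmod 1=a-[a]\in[0,1)$, where $[a]$ is the integer part of $a$. For $t=s_{i_1}^{\varepsilon_1}\cdots s_{i_n}^{\varepsilon_n}\in G$ with $\varepsilon_j\in\mathbb{Z}$ and $x\in X$, $D_t(x)=f_{i_n}^{\varepsilon_n}(\cdots f_{i_1}^{\varepsilon_1}(x)\cdots)=(x+\varepsilon_1\theta_{i_1}+\cdots+\varepsilon_n\theta_{i_n})\bmod 1$. A point $x$ is a fixed point of the MDTDS if $D_t(x)=x$ for all $t\in G$; $\mathrm{Fix}(D^G_{\theta_1,\dots,\theta_{|S|}})$ denotes the set of fixed points. *)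

(* Defs.v *)
From HB Require Import structures.
From mathcomp Require Import all_boot all_order all_algebra.
From mathcomp Require Import all_classical all_reals.

Set Implicit Arguments.
Unset Strict Implicit.
Unset Printing Implicit Defensive.

Import Order.TTheory GRing.Theory Num.Theory.
Local Open Scope ring_scope.

(* Elements of the free group on [S] are the reduced words over the letters
   [(s, b)], where [(s, true)] stands for the generator [s] and [(s, false)] for
   its inverse. *)

Section FreeGroup.
Variable S : choiceType.
Implicit Types (a b : S * bool) (u v w : seq (S * bool)).

Definition letter_inv a : S * bool := (a.1, ~~ a.2).

Lemma letter_invK : involutive letter_inv.
Proof. by case=> s b; rewrite /letter_inv /= negbK. Qed.

Definition reduced w : bool := sorted (fun a b => b != letter_inv a) w.

Definition word_cons a w : seq (S * bool) :=
  if w is b :: w' then if b == letter_inv a then w' else a :: w else [:: a].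

Definition word_mul u v : seq (S * bool) := foldr word_cons v u.

Definition word_inv w : seq (S * bool) := rev (map letter_inv w).

Lemma reduced_behead a w : reduced (a :: w) -> reduced w.
Proof. by case: w => [|b w] //= /andP[]. Qed.

Lemma reduced_word_cons a w : reduced w -> reduced (word_cons a w).
Proof.
case: w => [|b w] //= rw; case: eqP => [_|/eqP ne].
  exact: (@reduced_behead b).
by rewrite /= ne.
Qed.

Lemma reduced_word_mul u v : reduced v -> reduced (word_mul u v).
Proof. by elim: u => //= a u IH rv; apply: reduced_word_cons; apply: IH. Qed.

Lemma word_cons_reduced a w : reduced (a :: w) -> word_cons a w = a :: w.
Proof. by case: w => [|b w] //= /andP[/negPf ->]. Qed.

Lemma word_consK a w : reduced w -> word_cons (letter_inv a) (word_cons a w) = w.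
Proof.
case: w => [|b w] /=; first by rewrite letter_invK eqxx.
move=> rw; case: (eqVneq b (letter_inv a)) => [<-|ne] /=.
  exact: word_cons_reduced.
by rewrite letter_invK eqxx.
Qed.

Lemma word_muls0 u : reduced u -> word_mul u [::] = u.
Proof.
elim: u => //= a u IH ru; rewrite (IH (reduced_behead ru)).
exact: word_cons_reduced.
Qed.

Lemma word_mul_cons a u v :
  reduced v -> word_mul (word_cons a u) v = word_cons a (word_mul u v).
Proof.
case: u => [|b u] //= rv; case: eqP => [->|_] //=.
rewrite -{1}(letter_invK a) word_consK //; exact: reduced_word_mul.
Qed.

Lemma word_mulA u v w :
  reduced w -> word_mul u (word_mul v w) = word_mul (word_mul u v) w.
Proof.
by move=> rw; elim: u => //= a u ->; rewrite word_mul_cons.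
Qed.

Lemma word_mul_cat u v w : word_mul (u ++ v) w = word_mul u (word_mul v w).
Proof. exact: foldr_cat. Qed.

Lemma word_invK : involutive word_inv.
Proof. by move=> w; rewrite /word_inv map_rev revK mapK //; exact: letter_invK. Qed.

Lemma reduced_word_inv w : reduced w -> reduced (word_inv w).
Proof.
rewrite /reduced /word_inv rev_sorted sorted_map.
apply: sub_sorted => a b /= ne.
by rewrite letter_invK eq_sym.
Qed.

Lemma word_mulV w : word_mul (word_inv w) w = [::].
Proof.
elim: w => //= a w IH; rewrite /word_inv /= rev_cons -cats1 word_mul_cat /=.
by rewrite letter_invK eqxx.
Qed.

Record free_group : Type := FreeGroup {
  word :> seq (S * bool);
  word_reduced : reduced word }.

HB.instance Definition _ := [isSub for word].
HB.instance Definition _ := [Choice of free_group by <:].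

Definition fg_one : free_group := @FreeGroup [::] isT.
Definition fg_mul (t u : free_group) : free_group :=
  FreeGroup (reduced_word_mul t (word_reduced u)).
Definition fg_inv (t : free_group) : free_group :=
  FreeGroup (reduced_word_inv (word_reduced t)).

Lemma fg_mulA : associative fg_mul.
Proof. by move=> t u v; apply/val_inj/word_mulA/word_reduced. Qed.

Lemma fg_mul1 : left_id fg_one fg_mul.
Proof. by move=> t; apply: val_inj. Qed.

Lemma fg_mulr1 : right_id fg_one fg_mul.
Proof. by move=> t; apply/val_inj/word_muls0/word_reduced. Qed.

Lemma fg_mulV : left_inverse fg_one fg_inv fg_mul.
Proof. by move=> t; apply/val_inj/word_mulV. Qed.

Lemma fg_mulrV : right_inverse fg_one fg_inv fg_mul.
Proof.
by move=> t; apply: val_inj; rewrite /= -{1}(word_invK t) word_mulV.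
Qed.

HB.instance Definition _ :=
  isGroup.Build free_group fg_mulA fg_mul1 fg_mulr1 fg_mulV fg_mulrV.

Definition fg_gen (s : S) : free_group := @FreeGroup [:: (s, true)] isT.

Definition fg_gen_exp (s : S) (e : int) : free_group :=
  match e with
  | Posz n => (fg_gen s ^+ n)%g
  | Negz n => (fg_gen s ^- n.+1)%g
  end.

(* The pairs (s_{i_j}, e_j) are arbitrary: e_j = 0 and i_j = i_{j+1} are
   allowed. *)
Definition fg_prod (l : seq (S * int)) : free_group :=
  (\prod_(p <- l) fg_gen_exp p.1 p.2)%g.

Lemma fg_prod_surj (t : free_group) : exists l, t = fg_prod l.
Proof.
exists [seq (a.1, if a.2 then 1 else -1 : int) | a <- word t].
case: t => w rw; apply: val_inj => /=; elim: w rw => [|[s b] w IH] rw.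
  by rewrite /fg_prod big_nil.
rewrite /fg_prod big_cons -/(fg_prod _) /=.
rewrite -(IH (reduced_behead rw)); case: b rw => rw /=;
  by rewrite word_cons_reduced.
Qed.

End FreeGroup.

(* [0, 1] with 0 and 1 identified is represented by its fundamental domain
   [0, 1); [circle_of] is the reduction a |-> a mod 1, and [circle_ofP] and
   [circle_ofK] say that it identifies [circle R] with R / Z. *)

Section Circle.
Variable R : realType.

Record circle : Type := Circle {
  circle_val :> R;
  circle_itv : 0 <= circle_val < 1 }.

HB.instance Definition _ := [isSub for circle_val].
HB.instance Definition _ := [Choice of circle by <:].

Definition mod1 (a : R) : R := a - (Num.floor a)%:~R.

Lemma mod1_itv (a : R) : 0 <= mod1 a < 1.
Proof.
by rewrite /mod1 subr_ge0 floor_le ltrBlDl -intrD1 floorD1_gt.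
Qed.

Definition circle_of (a : R) : circle := Circle (mod1_itv a).

Lemma circle_ofK (x : circle) : circle_of x = x.
Proof.
apply: val_inj; rewrite /= /mod1 (floor_def (m := 0)) ?subr0 //.
exact: circle_itv.
Qed.

Lemma circle_ofP (a b : R) :
  circle_of a = circle_of b <-> a - b \is a Num.int.
Proof.
split=> [/(congr1 val) /= /eqP|ab_int].
  rewrite /mod1 subr_eq addrAC -addrA -intrB => /eqP ->.
  by rewrite addrAC subrr add0r intr_int.
apply: val_inj; rewrite /= /mod1 -{1 2}(subrK b a) floorDzr ?inE // intrD.
by rewrite (floorK ab_int) opprD addrACA subrr add0r.
Qed.

End Circle.

Section MDTDS.
Variables (R : realType) (S : finType) (theta : S -> R).

Definition crot (s : S) (x : circle R) : circle R := circle_of (circle_val x + theta s).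

Definition crot_inv (s : S) (x : circle R) : circle R := circle_of (circle_val x - theta s).

Lemma crotK (s : S) : cancel (crot s) (crot_inv s).
Proof.
move=> x; rewrite -[RHS]circle_ofK; apply/circle_ofP => /=.
by rewrite /mod1 [X in X \is a _](_ : _ = - (Num.floor (circle_val x + theta s))%:~R)
  ?rpredN ?intr_int // (addrAC (circle_val x + _)) addrK addrAC subrr add0r.
Qed.

Lemma crot_invK (s : S) : cancel (crot_inv s) (crot s).
Proof.
move=> x; rewrite -[RHS]circle_ofK; apply/circle_ofP => /=.
by rewrite /mod1 [X in X \is a _](_ : _ = - (Num.floor (circle_val x - theta s))%:~R)
  ?rpredN ?intr_int // (addrAC (circle_val x - _)) subrK addrAC subrr add0r.
Qed.

Definition crot_exp (s : S) (e : int) (x : circle R) : circle R :=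
  match e with
  | Posz n => iter n (crot s) x
  | Negz n => iter n.+1 (crot_inv s) x
  end.

(* The leftmost letter acts first; by [mdtds_prod] this is
   f_{i_k}^{e_k} (... f_{i_1}^{e_1} (x) ...) for every way of writing [t] as
   s_{i_1}^{e_1} ... s_{i_k}^{e_k}. *)
Definition letter_act (x : circle R) (a : S * bool) : circle R :=
  if a.2 then crot a.1 x else crot_inv a.1 x.

Definition mdtds (t : free_group S) (x : circle R) : circle R :=
  foldl letter_act x (word t).

Lemma letter_actK (x : circle R) (a : S * bool) :
  letter_act (letter_act x a) (letter_inv a) = x.
Proof. by case: a => s [] /=; [exact: crotK | exact: crot_invK]. Qed.

Lemma mdtdsM (t u : free_group S) (x : circle R) :
  mdtds (t * u)%g x = mdtds u (mdtds t x).
Proof.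
rewrite /mdtds (_ : word (t * u)%g = word_mul t u) //.
elim: (word t) x => //= a w IH x; rewrite -IH.
case: (word_mul w u) => [|b v] //=; case: eqP => //= ->.
by rewrite letter_actK.
Qed.

Lemma mdtds_gen_exp (s : S) (e : int) (x : circle R) :
  mdtds (fg_gen_exp s e) x = crot_exp s e x.
Proof.
have genX n y : mdtds (fg_gen s ^+ n)%g y = iter n (crot s) y.
  by elim: n y => [|n IH] y //; rewrite expgS mdtdsM IH -iterSr.
have iterK n y : iter n (crot s) (iter n (crot_inv s) y) = y.
  by elim: n y => [|n IH] y //; rewrite iterSr iterS crot_invK.
case: e => n; first exact: genX.
by rewrite /= -iterS -{1}(iterK n.+1 x) -genX -mdtdsM mulgV.
Qed.

Lemma mdtds_prod (l : seq (S * int)) (x : circle R) :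
  mdtds (fg_prod l) x = foldl (fun y p => crot_exp p.1 p.2 y) x l.
Proof.
elim: l x => [|p l IH] x; first by rewrite /fg_prod big_nil.
by rewrite /fg_prod big_cons mdtdsM mdtds_gen_exp IH.
Qed.

Definition mdtds_fix : set (circle R) :=
  [set x | forall t : free_group S, mdtds t x = x].

End MDTDS.

(* Main.v *)
Require Import Defs.
From mathcomp Require Import all_boot all_order all_algebra.
From mathcomp Require Import all_classical all_reals.

Import Order.TTheory GRing.Theory Num.Theory.
Local Open Scope classical_set_scope.
Local Open Scope ring_scope.

(** On $\mathbb{R}/\mathbb{Z}$ a rotation by $\theta_s$ moves every point by the same class, so it
    fixes a point exactly when $\theta_s\in\mathbb{Z}$, whichever the point ([crot_fixP]). A point
    fixed by all generators is fixed by their inverses, hence by every word. So [mdtds_fixP] gives a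
    criterion independent of [x]: the fixed set is empty or the whole circle. *)

Lemma crot_fixP (R : realType) (S : finType) (theta : S -> R) (s : S)
    (x : circle R) :
  crot theta s x = x <-> theta s \is a Num.int.
Proof.
(* Writing [x] as [circle_of x] turns the equation into $(x+\theta_s)-x\in\mathbb{Z}$. *)
by rewrite -[X in _ = X]circle_ofK /crot circle_ofP addrAC subrr add0r.
Qed.

Lemma letter_act_fix (R : realType) (S : finType) (theta : S -> R)
    (x : circle R) (a : S * bool) :
  crot theta a.1 x = x -> letter_act theta x a = x.
Proof.
by rewrite /letter_act; case: a.2 => //= fx; rewrite -{1}fx crotK.
Qed.

Lemma mdtds_fixP (R : realType) (S : finType) (theta : S -> R) (x : circle R) :
  mdtds_fix theta x <-> forall s : S, theta s \is a Num.int.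
Proof.
split=> [fx s | theta_int t].
  (* The one-letter word [fg_gen s] acts as [crot theta s] by computation. *)
  by apply/(crot_fixP _ _ theta s x); exact: (fx (fg_gen s)).
rewrite /mdtds; elim: (word t) => //= a w IH.
by rewrite letter_act_fix //; exact/crot_fixP.
Qed.

Theorem theorem6p1 (R : realType) (S : finType) (theta : S -> R)
    (theta_gt0 : forall s : S, 0 < theta s) :
  ((exists s0 : S, theta s0 \isn't a Num.int) ->
     mdtds_fix theta = set0) /\
  ((forall s : S, theta s \is a Num.int) ->
     [set circle_val x | x in mdtds_fix theta] = `[0, 1[%classic).
Proof.
split=> [[s0 /negP s0_nint]|theta_int].
  by rewrite -subset0 => x /mdtds_fixP /(_ s0).
apply/seteqP; split=> [_ [x _ <-]|y] /=; rewrite in_itv /=.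
  exact: circle_itv.
(* [y] is its own representative in the fundamental domain. *)
by move=> y01; exists (Circle y01) => //; exact/mdtds_fixP.
Qed.
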